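(* Let $\alpha\in(0,1)$. For every $s>0$, the density of $V_\alpha^s$ is decreasing and log-convex on its domain of definition, i.e. on the half-line that is the support of $V_\alpha^s$.
   Context: For $\alpha\in(0,1)$ put $\beta=1-\alpha$ and $$b_\alpha(u)=\Big(\frac{\sin u}{\sin(\alpha u)}\Big)^{\alpha}\Big(\frac{\sin u}{\sin(\beta u)}\Big)^{\beta},\qquad u\in(0,\pi).$$ The function $b_\alpha$ is decreasing on $(0,\pi)$. Let $U$ be uniformly distributed on $(0,\pi)$ and set $V_\alpha=b_\alpha(U)^{-1/\beta}$. The support of $V_\alpha$ is $[\beta\alpha^{\alpha/\beta},\infty)$. A positive function is log-convex if its logarithm is convex. *)

(* Defs.v *)
From HB Require Import structures.
From mathcomp Require Import all_boot all_order all_algebra.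
From mathcomp Require Import all_classical all_reals all_analysis.
From mathcomp Require Import measurable_realfun.

Set Implicit Arguments.
Unset Strict Implicit.
Unset Printing Implicit Defensive.

Import Order.TTheory GRing.Theory Num.Theory.
Import numFieldNormedType.Exports.

Local Open Scope classical_set_scope.
Local Open Scope ring_scope.

Section b_and_V.
Context {R : realType}.

Definition b_ (alpha u : R) : R :=
  let beta := 1 - alpha in
  (sin u / sin (alpha * u)) `^ alpha * (sin u / sin (beta * u)) `^ beta.

Definition V_ (alpha : R) d (T : measurableType d) (U : T -> R) (w : T) : R :=
  let beta := 1 - alpha in b_ alpha (U w) `^ (- beta^-1).

Definition powRV d (T : measurableType d) (X : T -> R) (s : R) (w : T) : R :=
  X w `^ s.

Lemma measurable_invR : measurable_fun [set: R] (@GRing.inv R).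
Proof.
rewrite -(setvU [set (0 : R)]).
apply/measurable_funU; [exact: measurableC|by []|split]; last first.
  exact: measurable_fun_set1.
apply: open_continuous_measurable_fun.
  exact/closed_openC/accessible_closed_set1/hausdorff_accessible/Rhausdorff.
by move=> x; rewrite inE/= => /eqP x0; exact: inv_continuous.
Qed.

Lemma measurable_b_ alpha : measurable_fun [set: R] (b_ alpha).
Proof.
have msin : measurable_fun [set: R] (@sin R).
  by apply: continuous_measurable_fun; exact: continuous_sin.
have ms c : measurable_fun [set: R] (fun u : R => sin u / sin (c * u)).
  apply: measurable_funM => //.
  apply: (measurableT_comp measurable_invR).
  by apply: (measurableT_comp msin); exact: mulrl_measurable.
by apply: measurable_funM;
  apply: (@measurableT_comp _ _ _ _ _ _ (@powR R ^~ _)) => //; exact: ms.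
Qed.

Lemma measurable_V_ alpha d (T : measurableType d) (U : {mfun T >-> R}) :
  measurable_fun [set: T] (V_ alpha U).
Proof.
apply: (@measurableT_comp _ _ _ _ _ _ (@powR R ^~ _)) => //.
by apply: (measurableT_comp (measurable_b_ alpha)).
Qed.

HB.instance Definition _ alpha d (T : measurableType d)
    (U : {mfun T >-> R}) :=
  isMeasurableFun.Build _ _ _ _ (V_ alpha U) (measurable_V_ alpha U).

Lemma measurable_powRV d (T : measurableType d) (X : {mfun T >-> R}) (s : R) :
  measurable_fun [set: T] (powRV X s).
Proof. exact: (@measurableT_comp _ _ _ _ _ _ (@powR R ^~ _)). Qed.

HB.instance Definition _ d (T : measurableType d) (X : {mfun T >-> R})
    (s : R) :=
  isMeasurableFun.Build _ _ _ _ (powRV X s) (measurable_powRV X s).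

End b_and_V.

(* As for Radon-Nikodym derivatives, densities take values in [0, +oo]: a
   density may blow up at an endpoint of the support. *)
Definition is_density {R : realType} (m : set R -> \bar R) (f : R -> \bar R) :=
  [/\ measurable_fun [set: R] f, forall x, (0 <= f x)%E &
      forall A : set R, measurable A ->
        m A = (\int[lebesgue_measure]_(x in A) f x)%E].

(* f is positive on D and lne \o f is convex on D, for f with values in
   ]0, +oo]. The sum on the right is never of the form +oo - oo because
   lne (f x) > -oo, and 0 * +oo = 0 makes the cases t = 0 and t = 1 trivial. *)
Definition log_convex_on {R : realType} (D : set R) (f : R -> \bar R) :=
  (forall x, D x -> (0 < f x)%E) /\
  (forall x y t : R, D x -> D y -> 0 <= t <= 1 ->
    (lne (f (t * x + (1 - t) * y)%R) <=
      t%:E * lne (f x) + (1 - t)%:E * lne (f y))%E).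

(* Main.v *)
From HB Require Import structures.
Require Import Defs.
From mathcomp Require Import all_boot all_order all_algebra.
From mathcomp Require Import all_classical all_reals all_analysis.
From mathcomp Require Import measurable_realfun ring lra.

(* Put a = alpha, b = beta, and let [psi] be the reciprocal of the derivative of
   - ln b_alpha on ]0, pi[. The variable V^s is X(U) with X = exp (c N),
   N = - ln b_alpha, c = s / b, so if u(x) is the inverse of X its density is
   psi(u(x)) / (pi c x), and the logarithmic derivative of the density is
   (psi'(u(x)) / c - 1) / x. Everything thus follows from psi' <= 0 and from the
   convexity of psi.
   With p = cot (a u), q = cot (b u) and r = a p - b q, the addition formula for
   cot gives psi = (p + q) / (1 + r^2), and (psi, r) solves an autonomous
   polynomial system, so that psi'' is a polynomial in (psi, r). It is
   nonnegative as soon as z = a b psi r is nonincreasing in u and bounded by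
   (b - a) / 3, its limit at 0 (when a <= b; the other case is symmetric). Both
   facts follow from explicit integrating factors, each giving a function with
   nonnegative derivative that vanishes at 0. *)

Import Order.TTheory GRing.Theory Num.Theory.
Import numFieldNormedType.Exports.

Local Open Scope classical_set_scope.
Local Open Scope ring_scope.

(** * Derivatives and monotonicity *)

Section pointwise_derivation.
Context {R : realType}.
Implicit Types (f g : R -> R) (x k : R).

Lemma is_derive_cstf x k : is_derive x 1 (fun _ : R => k) 0.
Proof. exact: is_derive_cst. Qed.

Lemma is_derive_idf x : is_derive x 1 (fun y : R => y) 1.
Proof. exact: is_derive_id. Qed.

Lemma is_deriveDf f g x df dg : is_derive x 1 f df -> is_derive x 1 g dg ->
  is_derive x 1 (fun y => f y + g y) (df + dg).
Proof. by move=> ? ?; exact: is_deriveD. Qed.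

Lemma is_deriveNf f x df : is_derive x 1 f df ->
  is_derive x 1 (fun y => - f y) (- df).
Proof. by move=> ?; exact: is_deriveN. Qed.

Lemma is_deriveMf f g x df dg : is_derive x 1 f df -> is_derive x 1 g dg ->
  is_derive x 1 (fun y => f y * g y) (df * g x + f x * dg).
Proof.
move=> ? ?; apply: (is_derive_eq (f := f * g)).
by rewrite /GRing.scale/= addrC [g x * _]mulrC.
Qed.

Lemma is_deriveXf f n x df : is_derive x 1 f df ->
  is_derive x 1 (fun y => f y ^+ n.+1) (n.+1%:R * f x ^+ n * df).
Proof.
move=> ?; rewrite [X in is_derive _ _ X](_ : _ = f ^+ n.+1).
  by apply: is_derive_eq.
by apply/funext => y; rewrite exprfctE.
Qed.

Lemma is_deriveVf f x df : f x != 0 -> is_derive x 1 f df ->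
  is_derive x 1 (fun y => (f y)^-1) (- df / f x ^+ 2).
Proof.
move=> fx0 /(is_deriveV fx0) fV; apply: (is_derive_eq fV).
by rewrite /GRing.scale/= !mulNr mulrC.
Qed.

Lemma is_derive_compf f g x df dg :
  is_derive (g x) 1 f df -> is_derive x 1 g dg ->
  is_derive x 1 (fun y => f (g y)) (df * dg).
Proof. by move=> ? ?; exact: is_derive1_comp. Qed.

Lemma is_derive_continuous f x df : is_derive x 1 f df -> {for x, continuous f}.
Proof. by move=> [fx _]; exact/differentiable_continuous/derivable1_diffP. Qed.

End pointwise_derivation.

(* [notypeclasses refine]: otherwise the instances of the library fire first and
   produce derivatives written with [*:]. *)
Ltac derive_tac :=
  notypeclasses refine (is_derive_eq _ _);
  [ repeat first
     [ eassumption
     | notypeclasses refine (is_derive_cstf _ _)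
     | notypeclasses refine (is_derive_idf _)
     | notypeclasses refine (is_deriveDf _ _ _ _ _ _ _)
     | notypeclasses refine (is_deriveNf _ _ _ _)
     | notypeclasses refine (is_deriveMf _ _ _ _ _ _ _)
     | notypeclasses refine (is_deriveXf _ _ _ _ _)
     | notypeclasses refine (is_derive_sin _)
     | notypeclasses refine (is_derive_cos _) ]
  | cbv beta ].

Section monotonicity.
Context {R : realType}.
Implicit Types (f df : R -> R) (l r : R).

Lemma MVT_itvoo f df l r x y :
  (forall z, l < z < r -> is_derive z 1 f (df z)) ->
  l < x -> x < y -> y < r ->
  exists2 c, x < c < y & f y - f x = df c * (y - x).
Proof.
move=> fdf lx xy yr.
have [||c] := @MVT R f df x y xy.
- move=> z; rewrite in_itv/= => /andP[xz zy].
  by apply: fdf; rewrite (lt_trans lx xz) (lt_trans zy yr).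
- apply: continuous_in_subspaceT => z; rewrite inE/= in_itv/= => /andP[xz zy].
  apply: is_derive_continuous; apply: fdf.
  by rewrite (lt_le_trans lx xz) (le_lt_trans zy yr).
- by rewrite in_itv/= => cxy fE; exists c.
Qed.

Lemma nondecreasing_itvoo f df l r :
  (forall z, l < z < r -> is_derive z 1 f (df z)) ->
  (forall z, l < z < r -> 0 <= df z) ->
  forall x y, l < x -> x <= y -> y < r -> f x <= f y.
Proof.
move=> fdf df0 x y lx; rewrite le_eqVlt => /predU1P[->//|xy] yr.
have [c /andP[xc cy] fE] := MVT_itvoo _ _ _ _ _ _ fdf lx xy yr.
rewrite -subr_ge0 fE mulr_ge0 ?subr_ge0 ?(ltW xy)// df0//.
by rewrite (lt_trans lx xc) (lt_trans cy yr).
Qed.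

(** By monotonicity [f x] bounds [f y] from above for [y] close to [l], and these values tend to
    0. *)
Lemma ge0_itvoo f df l r :
  (forall z, l < z < r -> is_derive z 1 f (df z)) ->
  (forall z, l < z < r -> 0 <= df z) ->
  f x @[x --> l^'+] --> 0 ->
  forall x, l < x < r -> 0 <= f x.
Proof.
move=> fdf df0 f0 x /andP[lx xr].
apply: (cvgr_to_le f0); near=> y.
apply: (nondecreasing_itvoo _ _ _ _ fdf df0) => //.
by near: y; exact: nbhs_right_ltW.
Unshelve. all: by end_near. Qed.

End monotonicity.

(** * Convexity of the reciprocal slope *)

Section cotangent.
Context {R : realType}.
Implicit Types x y : R.

Definition cot x := cos x / sin x.

Lemma sin_neq0 x : 0 < x < pi -> sin x != 0.
Proof. by move=> /sin_gt0_pi/gt_eqF->. Qed.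

Lemma oneDcot2 x : sin x != 0 -> 1 + cot x ^+ 2 = (sin x ^+ 2)^-1.
Proof.
move=> s0; rewrite /cot expr_div_n cos2sin2 mulrBl divff ?expf_neq0//.
by rewrite mul1r addrC subrK.
Qed.

Lemma is_derive_cot x : sin x != 0 -> is_derive x 1 cot (- (1 + cot x ^+ 2)).
Proof.
move=> s0; have dV := is_deriveVf _ _ _ s0 (is_derive_sin x).
have dc := is_derive_cos x.
refine (is_derive_eq (is_deriveMf _ _ _ _ _ dc dV) _).
by rewrite /cot; field.
Qed.

Lemma cvg_right0 (f : R -> R) (df : R) : is_derive (0 : R) 1 f df -> f 0 = 0 ->
  f x @[x --> 0^'+] --> 0.
Proof.
move=> /is_derive_continuous fc f0; rewrite -[X in _ --> X]f0.
exact: cvg_at_right_filter.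
Qed.

(** The difference has derivative x sin x and vanishes at 0; equivalently, x cot x <= 1. *)
Lemma mulcos_le_sin x : 0 < x < pi -> x * cos x <= sin x.
Proof.
move=> x0; rewrite -subr_ge0.
have dF (z : R) : is_derive z 1 (fun y : R => sin y - y * cos y) (z * sin z).
  by derive_tac; ring.
apply: (ge0_itvoo (fun y => sin y - y * cos y) (fun z => z * sin z) 0 pi) => //.
- by move=> z /andP[z0 zpi]; rewrite mulr_ge0 ?(ltW z0)// ltW// sin_gt0_pi// z0.
- by apply: (cvg_right0 _ _ (dF 0)); rewrite sin0 mul0r subrr.
Qed.

(** The difference has derivative 2 sin^2 x and vanishes at 0. It carries the sign of the derivative
    of - x cot x. *)
Lemma mulsincos_le x : 0 < x < pi -> sin x * cos x <= x.
Proof.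
move=> x0; rewrite -subr_ge0.
have dF (z : R) :
    is_derive z 1 (fun y : R => y - sin y * cos y) (2 * sin z ^+ 2).
  derive_tac.
  have := cos2Dsin2 z; lra.
apply: (ge0_itvoo (fun y : R => y - sin y * cos y)
  (fun z => 2 * sin z ^+ 2) 0 pi) => //.
- by move=> z _; rewrite mulr_ge0// sqr_ge0.
- by apply: (cvg_right0 _ _ (dF 0)); rewrite sin0 mul0r subrr.
Qed.

Lemma mulcot_nincr x y : 0 < x -> x <= y -> y < pi -> y * cot y <= x * cot x.
Proof.
move=> x0 xy ypi; rewrite -lerN2.
apply: (nondecreasing_itvoo (fun y => - (y * cot y))
  (fun z => - (cot z - z * (1 + cot z ^+ 2))) 0 pi) => // z z0.
  have dc := is_derive_cot z (sin_neq0 z z0).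
  by derive_tac; ring.
have s0 := sin_gt0_pi z0; have sn0 := sin_neq0 z z0.
rewrite oneDcot2// /cot.
rewrite (_ : - _ = (z - sin z * cos z) / sin z ^+ 2); last by field.
by rewrite divr_ge0 ?sqr_ge0// subr_ge0 mulsincos_le.
Qed.

(** Both sides are squares of x / sin x, whose growth amounts to x cot x <= 1. *)
Lemma mul_oneDcot2_ndecr x y : 0 < x -> x <= y -> y < pi ->
  x ^+ 2 * (1 + cot x ^+ 2) <= y ^+ 2 * (1 + cot y ^+ 2).
Proof.
move=> x0 xy ypi.
apply: (nondecreasing_itvoo (fun y => y ^+ 2 * (1 + cot y ^+ 2))
  (fun z => 2 * z * (1 + cot z ^+ 2) * (1 - z * cot z)) 0 pi) => // z z0.
  have dc := is_derive_cot z (sin_neq0 z z0).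
  by derive_tac; ring.
have s0 := sin_gt0_pi z0; have sn0 := sin_neq0 z z0.
have zgt0 : 0 < z by case/andP: z0.
rewrite mulr_ge0//.
  by rewrite !mulr_ge0 ?(ltW zgt0)// addr_ge0 ?sqr_ge0.
by rewrite subr_ge0 /cot mulrA ler_pdivrMr// mul1r mulcos_le_sin.
Qed.

End cotangent.

(** For [y] near [l], [- (c * g y) <= f y <= f x], and the left side tends to 0. Only a crude lower
    bound near [l] is asked for, so no limit of [f] has to be computed where its ingredients blow
    up. *)
Lemma ge0_itvoo_bound {R : realType} (f df g : R -> R) (l r c e : R) :
  l < e ->
  (forall z, l < z < r -> is_derive z 1 f (df z)) ->
  (forall z, l < z < r -> 0 <= df z) ->
  g x @[x --> l^'+] --> 0 ->
  (forall z, l < z < r -> z <= e -> - (c * g z) <= f z) ->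
  forall x, l < x < r -> 0 <= f x.
Proof.
move=> le fdf df0 g0 gf x /andP[lx xr].
have : - (c * g x) @[x --> l^'+] --> - (c * 0).
  by apply: cvgN; apply: cvgM => //; exact: cvg_cst.
rewrite mulr0 oppr0 => cg0.
apply: (cvgr_to_le cg0); near=> y.
have yx : y <= x by near: y; exact: nbhs_right_ltW.
have ly : l < y by near: y; exact: nbhs_right_gt.
have ye : y <= e by near: y; exact: nbhs_right_ltW.
apply: (@le_trans _ _ (f y)).
  by apply: gf => //; rewrite ly (le_lt_trans yx xr).
exact: (nondecreasing_itvoo _ _ _ _ fdf df0).
Unshelve. all: by end_near. Qed.

(* The conclusion is half of psi'' as a function of y = psi and r, with k = a b
   and d = b - a; the last hypothesis says that z = k y r is nonincreasing. *)
Lemma psi_second_derivative_ge0 {R : realFieldType} (k d y r : R) :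
  0 < k -> 0 <= d -> 0 < y -> 0 <= r -> 3 * k * y * r <= d ->
  0 <= r * (1 + d * y * r - k * y ^+ 2 * r ^+ 2) - y * (d - 3 * k * y * r) ->
  0 <= d * r + y * (d ^+ 2 * r ^+ 2 - 3 * k * r ^+ 2 + k - d ^+ 2)
    + 4 * k * d * y ^+ 2 * r * (2 - r ^+ 2)
    + k ^+ 2 * y ^+ 3 * (3 * r ^+ 4 - 12 * r ^+ 2 + 1).
Proof.
move=> k0 d0 y0; rewrite le_eqVlt => /predU1P[<- _|r0 zd].
  (* The case r = 0 is treated apart because the main argument multiplies by r; here the last
     hypothesis forces d = 0. *)
  rewrite mul0r sub0r mulr0 subr0 oppr_ge0 pmulr_rle0// => d_le0.
  have -> : d = 0 by apply/le_anti; rewrite d_le0.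
  rewrite (_ : _ + _ = k * y + k ^+ 2 * y ^+ 3); last by ring.
  by rewrite addr_ge0// ltW// mulr_gt0// exprn_gt0.
set m := (X in 0 <= X -> _) => m0; set Q := (X in 0 <= X).
have z0 : 0 < k * y * r by rewrite !mulr_gt0.
have {}zd : 3 * (k * y * r) <= d by rewrite !mulrA.
have e0 : 0 < 1 + y * r * (d - k * y * r).
  by rewrite ltr_pwDl// mulr_ge0 ?mulr_ge0 ?(ltW y0) ?(ltW r0)// subr_ge0; lra.
(* With z = k y r and e = 1 + y r (d - z), the last hypothesis says that m = r e - y (d - 3 z) is
   nonnegative. Multiplied by r e > 0, [Q] becomes a polynomial in m whose coefficients are visibly
   nonnegative. *)
rewrite -(pmulr_rge0 _ r0) -(pmulr_lge0 _ e0).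
have -> : r * Q * (1 + y * r * (d - k * y * r)) =
    y ^+ 2 * (d - 2 * (k * y * r)) *
      (k + 2 * (k * y * r) * (d - 2 * (k * y * r))) +
    m * y * ((d - 2 * (k * y * r)) ^+ 2 + 2 * (k * y * r) ^+ 2 + k) +
    m ^+ 2 * (d - 3 * (k * y * r)).
  by rewrite /Q /m; ring.
have d2 : 0 <= d - 2 * (k * y * r) by lra.
have d3 : 0 <= d - 3 * (k * y * r) by lra.
move: m m0 d2 d3 (ltW k0) (ltW y0) (ltW z0) => {Q e0 zd} m m0.
move: (k * y * r) (d - 2 * _) (d - 3 * _) => z p q p0 q0 k_ge0 y_ge0 z_ge0.
by rewrite !(addr_ge0, mulr_ge0, sqr_ge0).
Qed.

(** * The polynomial differential system satisfied by [psi] and [rdiff] *)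

Section reciprocal_slope.
Context {R : realType}.
Implicit Types a b u : R.

Definition rdiff a b u := a * cot (a * u) - b * cot (b * u).

Definition psi a b u :=
  (cot (a * u) + cot (b * u)) / (1 + rdiff a b u ^+ 2).

(** The derivative of [psi], written as a polynomial in [psi] and [rdiff] so that differentiating
    once more stays polynomial. *)
Definition dpsi a b u :=
  -1 + a * b * psi a b u ^+ 2 * (3 * rdiff a b u ^+ 2 - 1)
  - 2 * (b - a) * rdiff a b u * psi a b u.

(** Exchanging the weights only changes the sign of [rdiff], which enters through its square; this
    reduces the study to a <= b. *)
Lemma psiC a b u : psi a b u = psi b a u.
Proof. by rewrite /psi /rdiff addrC -[in LHS]sqrrN opprB. Qed.

Lemma dpsiC a b u : dpsi a b u = dpsi b a u.
Proof.
rewrite /dpsi psiC (_ : rdiff a b u = - rdiff b a u); first by ring.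
by rewrite /rdiff opprB.
Qed.

Section fixed_weights.
Variables a b : R.
Hypotheses (a_gt0 : 0 < a) (b_gt0 : 0 < b) (ab1 : a + b = 1).

Let bE : b = 1 - a. Proof. by rewrite -ab1 addrAC subrr add0r. Qed.

Lemma mulr_itv0pi c u : 0 < c -> c <= 1 -> 0 < u < pi -> 0 < c * u < pi.
Proof.
move=> c0 c1 /andP[u0 upi]; rewrite mulr_gt0//=.
by rewrite (le_lt_trans _ upi)// ger_pMl.
Qed.

Lemma is_derive_cotM c u : 0 < c -> c <= 1 -> 0 < u < pi ->
  is_derive u 1 (fun v => cot (c * v)) (- (c * (1 + cot (c * u) ^+ 2))).
Proof.
move=> c0 c1 u0.
have dc := is_derive_cot _ (sin_neq0 _ (mulr_itv0pi _ _ c0 c1 u0)).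
have dM : is_derive u 1 (fun v => c * v) c by derive_tac; ring.
by refine (is_derive_eq (is_derive_compf _ _ _ _ _ dc dM) _); ring.
Qed.

Let a_le1 : a <= 1. Proof. by rewrite -ab1 lerDl ltW. Qed.
Let b_le1 : b <= 1. Proof. by rewrite -ab1 lerDr ltW. Qed.

Let r := rdiff a b.
Let y := psi a b.
Let w u := 1 + r u ^+ 2.

Let w_gt0 u : 0 < w u.
Proof. by rewrite /w ltr_pwDl// sqr_ge0. Qed.

(** Since psi w = cot (a u) + cot (b u), this is the addition formula for sin (a u + b u). It yields
    psi > 0 and later controls the growth of psi at 0. *)
Let sDE u : 0 < u < pi ->
  sin (a * u) * sin (b * u) * (y u * w u) = sin u.
Proof.
move=> u0.
have sa := sin_neq0 _ (mulr_itv0pi _ _ a_gt0 a_le1 u0).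
have sb := sin_neq0 _ (mulr_itv0pi _ _ b_gt0 b_le1 u0).
rewrite /y /psi divfK ?gt_eqF//; last exact: w_gt0.
rewrite -[u in RHS]mul1r -ab1 [in RHS]mulrDl sinD /cot; field.
by rewrite sb sa.
Qed.

Lemma psi_gt0 u : 0 < u < pi -> 0 < psi a b u.
Proof.
move=> u0; have sa := sin_gt0_pi (mulr_itv0pi _ _ a_gt0 a_le1 u0).
have sb := sin_gt0_pi (mulr_itv0pi _ _ b_gt0 b_le1 u0).
have := sin_gt0_pi u0; rewrite -(sDE _ u0).
by rewrite (pmulr_rgt0 _ (mulr_gt0 sa sb)) (pmulr_lgt0 _ (w_gt0 u)).
Qed.

(** With p, q the cotangents at a u, b u, the raw derivative is b^2 (1 + q^2) - a^2 (1 + p^2); the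
    relations psi w = p + q and a + b = 1 bring it to a form free of p and q. *)
Let is_derive_r u : 0 < u < pi ->
  is_derive u 1 r (w u * ((b - a) - 2 * (a * b) * y u * r u)).
Proof.
move=> u0; have da := is_derive_cotM _ _ a_gt0 a_le1 u0.
have db := is_derive_cotM _ _ b_gt0 b_le1 u0.
rewrite [X in is_derive _ _ X](_ : _ =
  fun v => a * cot (a * v) + - (b * cot (b * v)))//.
derive_tac.
have yw : y u * w u = cot (a * u) + cot (b * u).
  by rewrite /y /psi divfK ?gt_eqF//; exact: w_gt0.
transitivity (w u * (b - a) - 2 * (a * b) * (y u * w u) * r u); last by ring.
rewrite yw /w /r /rdiff.
by move: (cot _) (cot _) => p q; rewrite bE; ring.
Qed.

Let is_derive_w u : 0 < u < pi -> is_derive u 1 w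
  (2 * r u * (w u * ((b - a) - 2 * (a * b) * y u * r u))).
Proof.
move=> u0; have dr := is_derive_r _ u0.
rewrite [X in is_derive _ _ X](_ : _ = fun v => 1 + r v ^+ 2)//.
by derive_tac; ring.
Qed.

Lemma is_derive_psi u : 0 < u < pi -> is_derive u 1 (psi a b) (dpsi a b u).
Proof.
move=> u0; have da := is_derive_cotM _ _ a_gt0 a_le1 u0.
have db := is_derive_cotM _ _ b_gt0 b_le1 u0.
have dwV := is_deriveVf _ _ _ (lt0r_neq0 (w_gt0 u)) (is_derive_w _ u0).
rewrite [X in is_derive _ _ X](_ : _ =
  fun v => (cot (a * v) + cot (b * v)) * (w v)^-1)//.
derive_tac.
have yw : y u = (cot (a * u) + cot (b * u)) / w u by [].
have rE : r u = a * cot (a * u) - b * cot (b * u) by [].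
have := lt0r_neq0 (w_gt0 u); rewrite /dpsi -/y -/r yw rE /w rE.
move: (cot _) (cot _) => p q w0.
by rewrite bE; field; move: w0; rewrite bE.
Qed.

Let D u := sin (a * u) * sin (b * u).

(** The logarithmic derivative of [D] is a p + b q, rewritten through psi w = p + q and r = a p - b
    q. *)
Let is_derive_D u : 0 < u < pi ->
  is_derive u 1 D (D u * (2 * (a * b) * y u * w u - (b - a) * r u)).
Proof.
move=> u0.
have sa := sin_neq0 _ (mulr_itv0pi _ _ a_gt0 a_le1 u0).
have sb := sin_neq0 _ (mulr_itv0pi _ _ b_gt0 b_le1 u0).
have dM c : is_derive u 1 (fun v => c * v) c by derive_tac; ring.
have da := is_derive_compf _ _ _ _ _ (is_derive_sin (a * u)) (dM a).
have db := is_derive_compf _ _ _ _ _ (is_derive_sin (b * u)) (dM b).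
rewrite [X in is_derive _ _ X](_ : _ = fun v => sin (a * v) * sin (b * v))//.
derive_tac; rewrite /D.
rewrite -(mulrA _ (y u)) (_ : y u * w u = cot (a * u) + cot (b * u)).
  by rewrite /r /rdiff /cot bE; field; rewrite -bE sb sa.
by rewrite /y /psi divfK ?gt_eqF//; exact: w_gt0.
Qed.

Hypothesis ab : a <= b.

Let r_ge0 u : 0 < u < pi -> 0 <= r u.
Proof.
move=> /andP[u0 upi]; rewrite -(pmulr_rge0 _ u0) /r /rdiff mulrBr subr_ge0.
rewrite [leLHS]mulrA [leRHS]mulrA (mulrC u a) (mulrC u b).
apply: mulcot_nincr; rewrite ?mulr_gt0 ?ler_pM2r//.
by rewrite (le_lt_trans _ upi)// ger_pMl.
Qed.

(** Multiplied by w, the right side minus the left side is the derivative of r; multiplied further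
    by u^2, it compares (x / sin x)^2 at a u and b u. This is the preliminary bound z <= (b - a) /
    2. *)
Let z_le u : 0 < u < pi -> 2 * (a * b) * y u * r u <= b - a.
Proof.
move=> /[dup] u0pi /andP[u0 upi].
rewrite -subr_ge0 -(pmulr_rge0 _ (w_gt0 u)).
rewrite [leRHS](_ : _ =
  (b ^+ 2 * (1 + cot (b * u) ^+ 2)) - (a ^+ 2 * (1 + cot (a * u) ^+ 2))).
  rewrite subr_ge0 -(ler_pM2l (exprn_gt0 2 u0)) [leLHS]mulrA [leRHS]mulrA.
  rewrite -!exprMn !(mulrC u).
  apply: mul_oneDcot2_ndecr; rewrite ?mulr_gt0 ?ler_pM2r//.
  by rewrite (le_lt_trans _ upi)// ger_pMl.
transitivity (w u * (b - a) - 2 * (a * b) * (y u * w u) * r u); first by ring.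
rewrite (_ : y u * w u = cot (a * u) + cot (b * u)); last first.
  by rewrite /y /psi divfK ?gt_eqF//; exact: w_gt0.
rewrite /w /r /rdiff.
by move: (cot _) (cot _) => p q; rewrite bE; ring.
Qed.

Let r_ndecr u v : 0 < u -> u <= v -> v < pi -> r u <= r v.
Proof.
apply: (nondecreasing_itvoo _ _ _ _ is_derive_r) => z z0.
by rewrite mulr_ge0 ?(ltW (w_gt0 z))// subr_ge0 z_le.
Qed.

Let D_gt0 u : 0 < u < pi -> 0 < D u.
Proof. by move=> u0; rewrite mulr_gt0// sin_gt0_pi// mulr_itv0pi. Qed.

Let D_le1 u : 0 < u < pi -> D u <= 1.
Proof.
by move=> u0; rewrite mulr_ile1 ?sin_le1// ltW// sin_gt0_pi// mulr_itv0pi.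
Qed.

(** As [r] is nondecreasing, [w] is bounded near 0 by a constant; the boundary estimates at 0 rely
    on it. *)
Let w_le1 u : 0 < u < pi -> u <= 1 -> w u <= w 1.
Proof.
move=> u0 u1; have lt1pi : 1 < pi :> R.
  by rewrite (lt_le_trans _ (pi_ge2 R))// ltr1n.
have ru1 : r u <= r 1 by apply: r_ndecr => //; case/andP: u0.
by rewrite lerD2l lerXn2r ?nnegrE ?r_ge0 ?ltr01.
Qed.

(* [- a b * barrier] is the derivative of [a b * psi * r]. *)
Let barrier u := r u * (1 + (b - a) * y u * r u - a * b * y u ^+ 2 * r u ^+ 2)
  - y u * ((b - a) - 3 * (a * b) * y u * r u).

Let yr_ge0 u : 0 < u < pi -> 0 <= y u * r u.
Proof. by move=> u0; rewrite mulr_ge0 ?r_ge0// ltW// psi_gt0. Qed.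

Let ab_gt0 : 0 < a * b. Proof. exact: mulr_gt0. Qed.

Let E_ge0 u : 0 < u < pi ->
  0 <= 1 + (b - a) * y u * r u - a * b * y u ^+ 2 * r u ^+ 2.
Proof.
move=> u0; have := z_le _ u0; have := yr_ge0 _ u0.
rewrite (_ : 1 + _ - _ =
  1 + y u * r u * ((b - a) - a * b * (y u * r u))); last by ring.
move=> t0 zd; rewrite addr_ge0// mulr_ge0// subr_ge0.
have : 0 <= a * b * (y u * r u) by rewrite mulr_ge0// ltW.
by move: zd; rewrite -!mulrA; lra.
Qed.

(* [D^2 w^2] is the integrating factor cancelling the term in [barrier]. *)
Let is_derive_barrier u : 0 < u < pi -> is_derive u 1
  (fun v => D v ^+ 2 * w v ^+ 2 * barrier v)
  (2 * D u ^+ 2 * w u ^+ 3 * (b - a - 2 * (a * b) * y u * r u) *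
   (1 + (b - a) * y u * r u - a * b * y u ^+ 2 * r u ^+ 2)).
Proof.
move=> u0; have dr := is_derive_r _ u0; have dw := is_derive_w _ u0.
have dD := is_derive_D _ u0; have dy : is_derive u 1 y _ := is_derive_psi _ u0.
rewrite /barrier; derive_tac; rewrite /dpsi -/y -/r /w.
by move: (D u) (y u) (r u) => *; rewrite bE; ring.
Qed.

Let sin_cvg0 : (fun u : R => sin u) x @[x --> 0^'+] --> 0.
Proof. by apply: cvg_right0; exact: sin0. Qed.

Let barrier_ge0 u : 0 < u < pi -> 0 <= barrier u.
Proof.
move=> u0; have D0 := D_gt0 _ u0.
rewrite -(pmulr_rge0 _ (mulr_gt0 (exprn_gt0 2 D0) (exprn_gt0 2 (w_gt0 u)))).
apply: (ge0_itvoo_bound _ _ _ _ _ ((b - a) * w 1) 1 _ is_derive_barrier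
  _ sin_cvg0) u0 => // [z z0|z z0 z1].
  apply: mulr_ge0; last exact: E_ge0.
  apply: mulr_ge0; last by rewrite subr_ge0 z_le.
  apply: mulr_ge0; last by rewrite exprn_ge0 ?(ltW (w_gt0 z)).
  by apply: mulr_ge0; rewrite ?sqr_ge0.
have -> : - ((b - a) * w 1 * sin z) =
    - ((b - a) * (D z * sin z * w 1)) + (b - a) * ((D z - 1) * w 1 * sin z).
  by ring.
have y0 := psi_gt0 _ z0; rewrite -/y in y0.
have Dz0 := D_gt0 _ z0; have Dz1 := D_le1 _ z0.
have s0 := sin_gt0_pi z0.
have wz1 := w_le1 _ z0 z1.
have d0 : 0 <= b - a by rewrite subr_ge0.
(* Apart from - (b - a) psi, what remains of [barrier] is nonnegative. Although psi blows up at 0, D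
   psi w = sin u turns D^2 w^2 psi into D w sin u, which is at most w(1) sin u. *)
have bz : - ((b - a) * y z) <= barrier z.
  rewrite -subr_ge0 (_ : _ - _ = r z * (1 + (b - a) * y z * r z -
    a * b * y z ^+ 2 * r z ^+ 2) + 3 * (a * b) * y z * (y z * r z)).
    apply: addr_ge0; first by rewrite mulr_ge0 ?r_ge0 ?E_ge0.
    apply: mulr_ge0; last exact: yr_ge0.
    by rewrite mulr_ge0 ?(ltW y0)// mulr_ge0// ltW.
  by rewrite /barrier; ring.
apply: (@le_trans _ _ (- ((b - a) * (D z * sin z * w 1)))).
  by rewrite gerDl mulr_ge0_le0// mulr_le0_ge0 ?(ltW s0)// mulr_le0_ge0
    ?subr_le0// ltW.
apply: (@le_trans _ _ (D z ^+ 2 * w z ^+ 2 * - ((b - a) * y z))).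
  rewrite -{1}(sDE _ z0) -/(D z) mulrN lerN2.
  rewrite [leLHS](_ : _ = (b - a) * (D z * (D z * (y z * w z)) * w z));
    last by ring.
  rewrite ler_wpM2l// ler_wpM2l// (sDE _ z0).
  exact: (mulr_ge0 (ltW Dz0) (ltW s0)).
by rewrite ler_wpM2l// mulr_ge0 ?sqr_ge0.
Qed.

(* [root4^3] is the integrating factor of the equation satisfied by
   [b - a - 3 a b psi r]. *)
Let root4 u := Num.sqrt (Num.sqrt (D u ^+ 2 * w u)).

(** The terms in r cancel in the derivative of D^2 w, which is 4 a b psi D^2 w; the fourth root
    divides this rate by 4. *)
Let is_derive_root4 u : 0 < u < pi ->
  is_derive u 1 root4 (root4 u * (a * b * y u)).
Proof.
move=> u0; have D0 := D_gt0 _ u0.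
have W0 : 0 < D u ^+ 2 * w u by rewrite mulr_gt0 ?exprn_gt0.
have sW0 : 0 < Num.sqrt (D u ^+ 2 * w u) by rewrite sqrtr_gt0.
have dw := is_derive_w _ u0; have dD := is_derive_D _ u0.
have dW : is_derive u 1 (fun v => D v ^+ 2 * w v)
    (D u ^+ 2 * w u * (4 * (a * b) * y u)).
  by derive_tac; rewrite /w; ring.
have ds := is_derive_compf Num.sqrt (fun v => D v ^+ 2 * w v) u _ _
  (is_derive1_sqrt W0) dW.
refine (is_derive_eq (is_derive_compf Num.sqrt
  (fun v => Num.sqrt (D v ^+ 2 * w v)) u _ _ (is_derive1_sqrt sW0) ds) _).
have sW := sqr_sqrtr (ltW W0); have ssW := sqr_sqrtr (ltW sW0).
have ssW0 : Num.sqrt (Num.sqrt (D u ^+ 2 * w u)) != 0.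
  by rewrite gt_eqF ?sqrtr_gt0.
rewrite /root4; move: ssW0 sW ssW.
move: (D u ^+ 2 * w u) => g; move: (Num.sqrt g) => g2.
move: (Num.sqrt g2) => g4 g4n gE g4E.
by rewrite -gE -g4E; field.
Qed.

Let z_le3 u : 0 < u < pi -> 3 * (a * b) * y u * r u <= b - a.
Proof.
move=> u0; have g0 v : 0 < v < pi -> 0 < root4 v.
  by move=> v0; rewrite !sqrtr_gt0 mulr_gt0 ?exprn_gt0// D_gt0.
rewrite -subr_ge0 -(pmulr_rge0 _ (exprn_gt0 3 (g0 _ u0))).
have dF v : 0 < v < pi -> is_derive v 1
    (fun v => root4 v ^+ 3 * (b - a - 3 * (a * b) * y v * r v))
    (3 * root4 v ^+ 3 * (a * b) * r v *
     (1 + (b - a) * y v * r v - a * b * y v ^+ 2 * r v ^+ 2)).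
  move=> v0; have dr := is_derive_r _ v0; have dg := is_derive_root4 _ v0.
  have dy : is_derive v 1 y _ := is_derive_psi _ v0.
  derive_tac; rewrite /dpsi -/y -/r /w.
  by move: (root4 v) (y v) (r v) => *; ring.
(* On ]0, 1] the product is at least - (b - a) root4^3 by [z_le], and root4^3 = D sqrt(w) root4 is
   at most [D] times a constant built from w(1). *)
apply: (ge0_itvoo_bound _ _ D _ _ ((b - a) * Num.sqrt (w 1) *
  Num.sqrt (Num.sqrt (w 1))) 1 _ dF _ _) u0 => // [v v0||v v0 v1].
- rewrite mulr_ge0 ?E_ge0// mulr_ge0 ?r_ge0// mulr_ge0 ?(ltW ab_gt0)//.
  by rewrite mulr_ge0// exprn_ge0// ltW// g0.
- have dM c : is_derive (0 : R) 1 (fun v => c * v) c by derive_tac; ring.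
  have da := is_derive_compf sin (fun v => a * v) 0 _ _
    (is_derive_sin _) (dM a).
  have db := is_derive_compf sin (fun v => b * v) 0 _ _
    (is_derive_sin _) (dM b).
  have dD := is_deriveMf _ _ _ _ _ da db.
  by apply: (cvg_right0 _ _ dD); rewrite mulr0 sin0 mul0r.
have D0 := D_gt0 _ v0; have wv1 := w_le1 _ v0 v1.
have W0 : 0 <= D v ^+ 2 * w v by rewrite mulr_ge0 ?sqr_ge0// ltW.
have sWE : Num.sqrt (D v ^+ 2 * w v) = D v * Num.sqrt (w v).
  by rewrite sqrtrM ?sqr_ge0// sqrtr_sqr gtr0_norm.
have sw1 : Num.sqrt (w v) <= Num.sqrt (w 1) by rewrite ler_wsqrtr.
have g2 : root4 v ^+ 2 = D v * Num.sqrt (w v).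
  by rewrite /root4 sqr_sqrtr ?sqrtr_ge0.
have g1 : root4 v <= Num.sqrt (Num.sqrt (w 1)).
  rewrite /root4 ler_wsqrtr// sWE -[leRHS]mul1r ler_pM ?sqrtr_ge0 ?D_le1//.
  exact: ltW.
have d0 : 0 <= b - a by rewrite subr_ge0.
have gv0 := ltW (g0 _ v0).
apply: (@le_trans _ _ (- ((b - a) * root4 v ^+ 3))).
  rewrite lerN2 [leRHS](_ : _ = (b - a) * (D v * Num.sqrt (w 1) *
    Num.sqrt (Num.sqrt (w 1)))); last by ring.
  rewrite ler_wpM2l// exprSr g2; apply: ler_pM => //.
    by rewrite mulr_ge0 ?sqrtr_ge0// ltW.
  by rewrite ler_wpM2l// ltW.
rewrite -mulNr mulrC ler_wpM2l ?exprn_ge0//.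
by have := z_le _ v0; rewrite -!mulrA; lra.
Qed.

Lemma dpsi_le0 u : 0 < u < pi -> dpsi a b u <= 0.
Proof.
move=> u0; rewrite /dpsi -/r -/y.
rewrite (_ : _ - _ = - (1 + a * b * y u ^+ 2 + (b - a) * (y u * r u) +
  (b - a - 3 * (a * b) * y u * r u) * (y u * r u))); last by ring.
have t0 := yr_ge0 _ u0; rewrite oppr_le0; apply: addr_ge0; last first.
  by rewrite mulr_ge0// subr_ge0 z_le3.
apply: addr_ge0; last by rewrite mulr_ge0// subr_ge0.
by rewrite addr_ge0// mulr_ge0 ?sqr_ge0// ltW.
Qed.

(** The derivative is twice the polynomial of [psi_second_derivative_ge0] with k = a b and d = b -
    a, whose last two hypotheses are [z_le3] and [barrier_ge0]. *)
Lemma dpsi_ndecr u v : 0 < u -> u <= v -> v < pi -> dpsi a b u <= dpsi a b v.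
Proof.
apply: (nondecreasing_itvoo _ (fun u => 2 *
  ((b - a) * r u + y u * ((b - a) ^+ 2 * r u ^+ 2 - 3 * (a * b) * r u ^+ 2 +
    a * b - (b - a) ^+ 2)
    + 4 * (a * b) * (b - a) * y u ^+ 2 * r u * (2 - r u ^+ 2)
    + (a * b) ^+ 2 * y u ^+ 3 * (3 * r u ^+ 4 - 12 * r u ^+ 2 + 1)))) => z z0.
  have dr := is_derive_r _ z0; have dy := is_derive_psi _ z0.
  rewrite /dpsi; derive_tac; rewrite /dpsi -/y -/r /w.
  by move: (y z) (r z) => *; ring.
rewrite mulr_ge0// psi_second_derivative_ge0 ?z_le3 ?r_ge0 ?psi_gt0//.
- by rewrite subr_ge0.
- exact: barrier_ge0.
Qed.

End fixed_weights.
End reciprocal_slope.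

(** * The function - ln b_alpha *)

Section minus_ln_b.
Context {R : realType}.
Implicit Types a b u : R.

Lemma dpsi_ndecr_sym a b u v : 0 < a -> 0 < b -> a + b = 1 ->
  0 < u -> u <= v -> v < pi -> dpsi a b u <= dpsi a b v.
Proof.
move=> a0 b0 ab1 u0 uv vpi; have [ab|/ltW ba] := leP a b.
  exact: dpsi_ndecr.
by rewrite !(dpsiC a b); apply: dpsi_ndecr => //; rewrite addrC.
Qed.

Lemma dpsi_le0_sym a b u : 0 < a -> 0 < b -> a + b = 1 -> 0 < u < pi ->
  dpsi a b u <= 0.
Proof.
move=> a0 b0 ab1 u0; have [ab|/ltW ba] := leP a b; first exact: dpsi_le0.
by rewrite dpsiC; apply: dpsi_le0 => //; rewrite addrC.
Qed.

(** The two terms in ln (sin u) of - ln b_alpha merge into one because a + b = 1. *)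
Definition Nlnb a b u :=
  a * ln (sin (a * u)) + b * ln (sin (b * u)) - ln (sin u).

Lemma sin_le (x : R) : 0 < x < pi -> sin x <= x.
Proof.
move=> x0; rewrite -subr_ge0.
have dF (z : R) : is_derive z 1 (fun y : R => y - sin y) (1 - cos z).
  by derive_tac.
apply: (ge0_itvoo (fun y : R => y - sin y) (fun z => 1 - cos z) 0 pi) => //.
by apply: (cvg_right0 _ _ (dF 0)); rewrite sin0 subrr.
Qed.

Section fixed_weights.
Variables a b : R.
Hypotheses (a_gt0 : 0 < a) (b_gt0 : 0 < b) (ab1 : a + b = 1).

Let bE : b = 1 - a. Proof. by rewrite -ab1 addrAC subrr add0r. Qed.
Let a_le1 : a <= 1. Proof. by rewrite -ab1 lerDl ltW. Qed.
Let b_le1 : b <= 1. Proof. by rewrite -ab1 lerDr ltW. Qed.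
Let a_lt1 : a < 1. Proof. by rewrite -ab1 ltrDl. Qed.
Let b_lt1 : b < 1. Proof. by rewrite -ab1 ltrDr. Qed.

Lemma is_derive_Nlnb u : 0 < u < pi ->
  is_derive u 1 (Nlnb a b) (psi a b u)^-1.
Proof.
move=> u0; have sa := sin_gt0_pi (mulr_itv0pi _ _ a_gt0 a_le1 u0).
have sb := sin_gt0_pi (mulr_itv0pi _ _ b_gt0 b_le1 u0).
have su := sin_gt0_pi u0.
have dM c : is_derive u 1 (fun v => c * v) c by derive_tac; ring.
have da := is_derive_compf sin (fun v => a * v) u _ _ (is_derive_sin _) (dM a).
have db := is_derive_compf sin (fun v => b * v) u _ _ (is_derive_sin _) (dM b).
have dla := is_derive_compf (@ln R) (fun v => sin (a * v)) u _ _
  (is_derive1_ln sa) da.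
have dlb := is_derive_compf (@ln R) (fun v => sin (b * v)) u _ _
  (is_derive1_ln sb) db.
have dlu := is_derive_compf (@ln R) sin u _ _
  (is_derive1_ln su) (is_derive_sin u).
rewrite [X in is_derive _ _ X](_ : _ = fun v =>
  a * ln (sin (a * v)) + b * ln (sin (b * v)) - ln (sin v))//.
derive_tac; rewrite /psi /rdiff /cot.
have sE : sin u = sin (a * u) * cos (b * u) + cos (a * u) * sin (b * u).
  by rewrite -sinD -mulrDl ab1 mul1r.
have cE : cos u = cos (a * u) * cos (b * u) - sin (a * u) * sin (b * u).
  by rewrite -cosD -mulrDl ab1 mul1r.
have Ca := cos2Dsin2 (a * u); have Cb := cos2Dsin2 (b * u).
move: su sa sb Ca Cb; rewrite cE sE.
move: (sin (a * u)) (cos (a * u)) (sin (b * u)) (cos (b * u)).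
move=> s c s1 c1 su0 s0 s10 _ _.
have {}s0 := lt0r_neq0 s0; have {}s10 := lt0r_neq0 s10.
(* Cosines become cotangents times sines. With sin u = s s1 (p + q), what is left is the rational
   identity between a^2 p + b^2 q - cot u and (1 + r^2) / (p + q). *)
have [cp cq] : c = c / s * s /\ c1 = c1 / s1 * s1 by rewrite !divfK.
move: (c / s) (c1 / s1) cp cq su0 => p q -> -> su0.
have pq0 : p + q != 0.
  apply: contraTneq su0 => pq0.
  by rewrite (_ : _ + _ = s * s1 * (p + q)); [rewrite pq0 mulr0 ltxx|ring].
rewrite (_ : s * _ + _ = s * s1 * (p + q)); last by ring.
by rewrite invf_div bE; field; rewrite s0 s10 pq0.
Qed.

Lemma Nlnb_ndecr u v : 0 < u -> u <= v -> v < pi ->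
  Nlnb a b u <= Nlnb a b v.
Proof.
apply: (nondecreasing_itvoo _ _ _ _ is_derive_Nlnb) => z z0.
by rewrite invr_ge0 ltW// psi_gt0.
Qed.

Lemma Nlnb_incr u v : 0 < u -> u < v -> v < pi -> Nlnb a b u < Nlnb a b v.
Proof.
move=> u0 uv vpi.
have [c /andP[uc cv] NE] := MVT_itvoo _ _ _ _ _ _ is_derive_Nlnb u0 uv vpi.
rewrite -subr_gt0 NE mulr_gt0 ?subr_gt0// invr_gt0 psi_gt0//.
by rewrite (lt_trans u0 uc) (lt_trans cv vpi).
Qed.

Let lim0 := a * ln a + b * ln b.

Let lt_pi (v : R) : v < 1 -> v < pi.
Proof.
move=> v1; apply: lt_le_trans v1 _.
by apply: le_trans (pi_ge2 R); rewrite ler1n.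
Qed.

Let cos_gt0 (v : R) : 0 < v < 1 -> 0 < cos v.
Proof.
move=> /andP[v0 v1]; apply: cos_gt0_pihalf.
rewrite (lt_le_trans v1 (pihalf_ge1 R)) andbT (lt_trans _ v0)//.
by rewrite oppr_lt0 divr_gt0// pi_gt0.
Qed.

Let ln_sinB (v : R) : 0 < v < 1 -> ln (cos v) <= ln (sin v) - ln v <= 0.
Proof.
move=> v01; have /andP[v0 v1] := v01.
have vpi : 0 < v < pi by rewrite v0 lt_pi.
have s0 := sin_gt0_pi vpi; have c0 := cos_gt0 _ v01.
rewrite subr_le0 ler_ln ?posrE// sin_le// andbT lerBrDr.
by rewrite -lnM ?posrE// ler_ln ?posrE ?mulr_gt0// mulrC mulcos_le_sin.
Qed.

(** The difference is a l(a u) + b l(b u) - l(u) with l(v) = ln (sin v / v). The three values of l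
    lie in [ln (cos u), 0], hence so does the weighted mean, and two points of this interval differ
    by at most - ln (cos u). *)
Let Nlnb_near0 u : 0 < u < 1 -> `|Nlnb a b u - lim0| <= - ln (cos u).
Proof.
move=> u01; have /andP[u0 u1] := u01.
have itvM c : 0 < c -> c <= 1 -> 0 < c * u < 1.
  by move=> c0 c1; rewrite mulr_gt0//= (le_lt_trans _ u1)// ger_pMl.
have au := itvM _ a_gt0 a_le1; have bu := itvM _ b_gt0 b_le1.
have -> : Nlnb a b u - lim0 = a * (ln (sin (a * u)) - ln (a * u)) +
    b * (ln (sin (b * u)) - ln (b * u)) - (ln (sin u) - ln u).
  rewrite !lnM ?posrE// /Nlnb /lim0.
  by move: (ln _) (ln _) (ln _) (ln _) (ln _) (ln _) => *; rewrite bE; ring.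
have lncos c : 0 < c -> c <= 1 -> ln (cos u) <= ln (cos (c * u)).
  move=> c0 c1; have /andP[cu0 cu1] := itvM _ c0 c1.
  rewrite ler_ln ?posrE ?cos_gt0 ?itvM// leNgt ltr_cos ?in_itv/=.
  - by rewrite -leNgt ger_pMl.
  - by rewrite ltW//= ltW// lt_pi.
  - by rewrite ltW//= ltW// lt_pi.
have /andP[sa1 sa2] := ln_sinB _ au; have /andP[sb1 sb2] := ln_sinB _ bu.
have /andP[su1 su2] := ln_sinB _ u01.
have ha := ler_wpM2l (ltW a_gt0) (le_trans (lncos _ a_gt0 a_le1) sa1).
have hb := ler_wpM2l (ltW b_gt0) (le_trans (lncos _ b_gt0 b_le1) sb1).
have ha' := mulr_ge0_le0 (ltW a_gt0) sa2.
have hb' := mulr_ge0_le0 (ltW b_gt0) sb2.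
have lE : ln (cos u) = a * ln (cos u) + b * ln (cos u).
  by rewrite -mulrDl ab1 mul1r.
rewrite ler_norml; apply/andP; split; lra.
Qed.

Let ln_cos_cvg0 : - ln (cos x) @[x --> (0 : R)^'+] --> (0 : R).
Proof.
have c1 : 0 < cos 0 :> R by rewrite cos0.
have dl := is_derive_compf (@ln R) cos 0 _ _
  (is_derive1_ln c1) (is_derive_cos 0).
by apply: (cvg_right0 _ _ (is_deriveNf _ _ _ dl)); rewrite cos0 ln1 oppr0.
Qed.

(** Passing to the limit at 0 gives only a weak inequality; it is applied at u / 2, and strict
    growth from u / 2 to u does the rest. *)
Lemma Nlnb_gt_lim0 u : 0 < u < pi -> a * ln a + b * ln b < Nlnb a b u.
Proof.
move=> /andP[u0 upi].
have u2 : u / 2 < u by rewrite ltr_pdivrMr// ltr_pMr// ltr1n.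
have u20 : 0 < u / 2 by rewrite divr_gt0.
apply: le_lt_trans (Nlnb_incr _ _ u20 u2 upi).
have u2pi : 0 < u / 2 < pi by rewrite u20 (lt_trans u2).
rewrite -subr_ge0.
apply: (ge0_itvoo_bound (fun u => Nlnb a b u - lim0) (fun u => (psi a b u)^-1)
  _ 0 pi 1 2^-1 _ _ _ ln_cos_cvg0) u2pi => // z z0.
- have dN := is_derive_Nlnb _ z0.
  by derive_tac; ring.
- by rewrite invr_ge0 ltW// psi_gt0.
- move=> z2; rewrite mul1r.
  have z01 : 0 < z < 1.
    case/andP: z0 => -> _ /=; apply: le_lt_trans z2 _.
    by rewrite invf_lt1 ?ltr1n.
  by have := Nlnb_near0 _ z01; rewrite ler_norml => /andP[].
Qed.

Lemma Nlnb_surj t : a * ln a + b * ln b < t ->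
  exists2 u, 0 < u < pi & Nlnb a b u = t.
Proof.
move=> t0.
have [u1 u10 u1t] : exists2 u, 0 < u < pi & Nlnb a b u < t.
  have gt0 : \forall u \near (0 : R)^'+, `|0 - (- ln (cos u))| < t - lim0.
    by move/cvgrPdist_lt : ln_cos_cvg0; apply; rewrite subr_gt0.
  have : \forall u \near (0 : R)^'+, 0 < u < pi /\ Nlnb a b u < t.
    near=> u.
    have u0 : 0 < u by near: u; exact: nbhs_right_gt.
    have u1 : u < 1 by near: u; exact: nbhs_right_lt.
    split; first by rewrite u0 lt_pi.
    have u01 : 0 < u < 1 by rewrite u0.
    have : `|0 - (- ln (cos u))| < t - lim0 by near: u.
    rewrite sub0r opprK -normrN => /(le_lt_trans (ler_norm _)).
    by have := Nlnb_near0 _ u01; rewrite ler_norml => /andP[_]; lra.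
  by move=> /filter_ex[u [? ?]]; exists u.
have [u2 u20 u2t] : exists2 u, 0 < u < pi & t < Nlnb a b u.
  (* Near pi, [h] stays above h(pi) - 1, being continuous there because a, b < 1, while - ln (sin u)
     is unbounded: h(u) - ln (sin u) > t once sin u < exp (h(pi) - 1 - t). *)
  pose h v := a * ln (sin (a * v)) + b * ln (sin (b * v)).
  have hpi : h x @[x --> (pi : R)^'-] --> h pi.
    apply: cvg_at_left_filter; apply: (@is_derive_continuous _ h pi _).
    have dM c : is_derive (pi : R) 1 (fun v => c * v) c by derive_tac; ring.
    have sM c : 0 < c -> c < 1 -> 0 < sin (c * pi) :> R.
      move=> c0 c1; apply: sin_gt0_pi.
      by rewrite mulr_gt0 ?pi_gt0//= gtr_pMl// pi_gt0.
    have dl c : 0 < c -> c < 1 ->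
        is_derive pi 1 (fun v => ln (sin (c * v))) _ := fun c0 c1 =>
      is_derive_compf (@ln R) (fun v => sin (c * v)) pi _ _
        (is_derive1_ln (sM _ c0 c1))
        (is_derive_compf sin (fun v => c * v) pi _ _
          (is_derive_sin _) (dM c)).
    have da := dl _ a_gt0 a_lt1; have db := dl _ b_gt0 b_lt1.
    by rewrite /h; derive_tac.
  have spi : sin x @[x --> (pi : R)^'-] --> (0 : R).
    rewrite -[X in _ --> X](@sinpi R).
    exact/cvg_at_left_filter/continuous_sin.
  have near_h := cvgr_gt _ hpi (h pi - 1).
  have near_s := cvgr_lt _ spi _ (expR_gt0 (h pi - 1 - t)).
  have : \forall u \near (pi : R)^'-, 0 < u < pi /\ t < Nlnb a b u.
    near=> u.
    have upi : u < pi by near: u; exact: nbhs_left_lt.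
    have u0 : 0 < u by near: u; exact/nbhs_left_gt/pi_gt0.
    have u0pi : 0 < u < pi by rewrite u0.
    split=> //; have hu : h pi - 1 < h u.
      by near: u; apply: near_h; rewrite gtrBl.
    have su : sin u < expR (h pi - 1 - t).
      by near: u; apply: near_s.
    have := su; rewrite -[sin u]lnK ?posrE ?sin_gt0_pi// ltr_expR.
    by rewrite /Nlnb -/(h u); lra.
  by move=> /filter_ex[u [? ?]]; exists u.
have u12 : u1 <= u2.
  rewrite leNgt; apply/negP => u21.
  have /andP[u2_gt0 _] := u20; have /andP[_ u1pi] := u10.
  have := Nlnb_ndecr _ _ u2_gt0 (ltW u21) u1pi.
  by rewrite leNgt (lt_trans u1t u2t).
have [||u] := @IVT R (Nlnb a b) u1 u2 t u12.
- apply: continuous_in_subspaceT => u; rewrite inE/= in_itv/= => /andP[u1u uu2].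
  apply: (is_derive_continuous _ _ _ (is_derive_Nlnb _ _)).
  case/andP: u10 => u1_gt0 _; case/andP: u20 => _ u2_ltpi.
  by rewrite (lt_le_trans u1_gt0 u1u) (le_lt_trans uu2 u2_ltpi).
- by rewrite ge_min le_max (ltW u1t) (ltW u2t) orbT.
rewrite in_itv/= => /andP[u1u uu2] ut; exists u => //.
case/andP: u10 => u1_gt0 _; case/andP: u20 => _ u2_ltpi.
by rewrite (lt_le_trans u1_gt0 u1u) (le_lt_trans uu2 u2_ltpi).
Unshelve. all: by end_near. Qed.

End fixed_weights.
End minus_ln_b.

(** * Convexity from a nondecreasing derivative *)

Section tangent_line.
Context {R : realType}.

Lemma le_tangent (L dL : R -> R) (x0 m z : R) :
  (forall x, x0 < x -> is_derive x 1 L (dL x)) ->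
  (forall x y, x0 < x -> x <= y -> dL x <= dL y) ->
  x0 < m -> x0 < z -> L m + dL m * (z - m) <= L z.
Proof.
move=> LdL dLnd m0 z0; rewrite -lerBrDl.
have [zm|mz|->] := ltgtP z m; last by rewrite !subrr mulr0.
(* The right end [m + 1] only provides an open interval containing both points. *)
- have [||c /andP[zc cm] LE] :=
    MVT_itvoo L dL x0 (m + 1) z m _ z0 zm; rewrite ?ltrDl//.
    by move=> x /andP[x0x _]; exact: LdL.
  have -> : L z - L m = dL c * (z - m) by rewrite -opprB LE -mulrN opprB.
  rewrite -subr_ge0 -mulrBl mulr_le0 ?subr_le0 ?(ltW zm)// dLnd// ?(ltW cm)//.
  exact: lt_trans zc.
- have [||c /andP[mc cz] LE] :=
    MVT_itvoo L dL x0 (z + 1) m z _ m0 mz; rewrite ?ltrDl//.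
    by move=> x /andP[x0x _]; exact: LdL.
  by rewrite LE ler_wpM2r ?subr_ge0 ?(ltW mz)// dLnd// ltW.
Qed.

(** The tangent at the convex combination m lies below [L] at x and at y; in the weighted sum the
    slope terms cancel. *)
Lemma convex_ndecr_derive (L dL : R -> R) (x0 : R) :
  (forall x, x0 < x -> is_derive x 1 L (dL x)) ->
  (forall x y, x0 < x -> x <= y -> dL x <= dL y) ->
  forall x y t, x0 < x -> x0 < y -> 0 <= t <= 1 ->
  L (t * x + (1 - t) * y) <= t * L x + (1 - t) * L y.
Proof.
move=> LdL dLnd x y t xx0 yx0 /andP[t0 t1].
set m := t * x + (1 - t) * y.
have mx0 : x0 < m.
  have : Num.min x y <= m.
    have [xy|yx] := leP x y; rewrite /m.
      by have : 0 <= (1 - t) * (y - x); [rewrite mulr_ge0// subr_ge0|lra].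
    by have : 0 <= t * (x - y); [rewrite mulr_ge0// subr_ge0 ltW|lra].
  by apply: lt_le_trans; rewrite lt_min xx0.
have t1' : 0 <= 1 - t by rewrite subr_ge0.
have hx := ler_wpM2l t0 (le_tangent _ _ _ _ _ LdL dLnd mx0 xx0).
have hy := ler_wpM2l t1' (le_tangent _ _ _ _ _ LdL dLnd mx0 yx0).
apply: le_trans (lerD hx hy).
by rewrite le_eqVlt; apply/orP; left; apply/eqP; rewrite /m; ring.
Qed.

End tangent_line.

(** * Densities of increasing functions of a uniform variable *)

Section density_measure.
Context {R : realType}.
Variable f : R -> \bar R.

(* The proof arguments are there for the measure instance below to be found. *)
Definition density_measure (mf : measurable_fun [set: R] f)
    (f0 : forall x, (0 <= f x)%E) (A : set R) : \bar R :=
  (\int[lebesgue_measure]_(x in A) f x)%E.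

Hypotheses (mf : measurable_fun [set: R] f) (f0 : forall x, (0 <= f x)%E).

Let m := density_measure mf f0.

Let m0 : m set0 = 0%E. Proof. exact: integral_set0. Qed.

Let m_ge0 A : (0 <= m A)%E.
Proof. by apply: integral_ge0 => x _; exact: f0. Qed.

Let m_sigma_additive : semi_sigma_additive m.
Proof.
move=> /= F mF tF mUF; rewrite /m /density_measure; apply: cvg_toP.
  apply: ereal_nondecreasing_is_cvgn => i j ij.
  by apply: lee_sum_nneg_natr => // k _ _; exact: m_ge0.
by rewrite ge0_integral_bigcup//; exact: measurable_funTS.
Qed.

HB.instance Definition _ := isMeasure.Build _ _ _ m
  m0 m_ge0 m_sigma_additive.

Definition measure_of_density : {measure set R -> \bar R} := m.

End density_measure.

(** * Finite measures determined by their values on rays *)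

Section rays.
Context {R : realType}.
Variables m1 m2 : {measure set R -> \bar R}.

(** Open right rays are stable under intersection, generate the Borel sets and cover the line. *)
Lemma measure_unique_ray :
  (forall c : R, m1 `]c, +oo[%classic = m2 `]c, +oo[%classic) ->
  (m1 [set: R] < +oo)%E ->
  forall A, measurable A -> m1 A = m2 A.
Proof.
move=> m12 m1oo A mA.
have cover : \bigcup_n `]- (n%:R : R), +oo[%classic = [set: R].
  apply/seteqP; split => // x _; exists (Num.bound `|x|) => //=.
  rewrite in_itv/= andbT ltrNl (le_lt_trans (ler_norm _))// normrN.
  by apply: archi_boundP; rewrite normr_ge0.
have mG : @RGenOInfty.G R `<=` @measurable _ R.
  by move=> _ [c ->].
have gG n : @RGenOInfty.G R `]- (n%:R : R), +oo[%classic by exists (- n%:R).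
apply: (@g_sigma_algebra_measure_unique _ _ _ _ mG _ gG cover m1 m2).
- move=> _ _ [c ->] [c' ->]; exists (Num.max c c').
  apply/seteqP; split => z /=; rewrite !in_itv/= !andbT gt_max.
    by case=> -> ->.
  by move=> /andP.
- by move=> _ [c ->].
- move=> n; apply: le_lt_trans m1oo.
  by apply: le_measure; rewrite ?inE.
- have : (@ocitv R).-sigma.-measurable A by [].
  by rewrite RGenOInfty.measurableE.
Qed.

(** A ray starting at or below x0 has the mass of ]x0, +oo[, which is the limit of the masses of ]x0
    + 1/(n+1), +oo[. *)
Lemma measure_unique_ray_above x0 :
  (forall c : R, x0 < c -> m1 `]c, +oo[%classic = m2 `]c, +oo[%classic) ->
  m1 `]-oo, x0]%classic = 0%E -> m2 `]-oo, x0]%classic = 0%E ->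
  (m1 [set: R] < +oo)%E ->
  forall A, measurable A -> m1 A = m2 A.
Proof.
move=> m12 m10 m20 m1oo; apply: measure_unique_ray => // c.
have [/m12//|cx0] := ltP x0 c.
have below (m : {measure set R -> \bar R}) :
    m `]-oo, x0]%classic = 0%E -> m `]c, +oo[%classic = m `]x0, +oo[%classic.
  move=> m0.
  have -> : `]c, +oo[%classic = (`]c, x0] `|` `]x0, +oo[)%classic :> set R.
    apply/seteqP; split => z /=; rewrite !in_itv/= !andbT.
      by move=> ->; have [zx|xz] := leP z x0; [left|right].
    by case=> [/andP[]//|]; exact: le_lt_trans.
  rewrite measureU//; last first.
    apply/seteqP; split => z //=; rewrite !in_itv/= andbT.
    by move=> [/andP[_ zx]]; rewrite ltNge zx.
  rewrite -[RHS]add0e; congr (_ + _)%E.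
  apply/eqP; rewrite eq_le measure_ge0 andbT -[leRHS]m0.
  apply: le_measure; rewrite ?inE//.
  by move=> z /=; rewrite !in_itv/= => /andP[].
rewrite !below//.
have above (m : {measure set R -> \bar R}) :
    m `]x0 + n.+1%:R^-1, +oo[%classic @[n --> \oo] --> m `]x0, +oo[%classic.
  have -> : `]x0, +oo[%classic =
      (\bigcup_n `]x0 + n.+1%:R^-1, +oo[%classic) :> set R.
    apply/seteqP; split => z /=; rewrite in_itv/= andbT; last first.
      move=> [n _]; rewrite /= in_itv/= andbT; apply: lt_trans.
      by rewrite ltrDl invr_gt0.
    move=> /ltr_add_invr[n xz]; exists n => //=.
    by rewrite in_itv/= andbT.
  apply: nondecreasing_cvg_mu => //.
  - exact: bigcupT_measurable.
  - move=> i j ij; apply/subsetPset => z /=; rewrite !in_itv/= !andbT.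
    apply: le_lt_trans; rewrite lerD2l lef_pV2 ?posrE// ler_nat.
    by rewrite ltnS.
have := above m1.
under eq_fun do rewrite m12 ?ltrDl ?invr_gt0//.
by move=> /cvg_lim <-//; have /cvg_lim := above m2; apply.
Qed.

End rays.

(** * Inverse of an increasing function and the resulting density *)

Section inverse.
Context {R : realType}.
Variables (l r x0 : R) (F f : R -> R).
Hypotheses (lr : l < r)
  (FdF : forall u, l < u < r -> is_derive u 1 F (f u))
  (f_gt0 : forall u, l < u < r -> 0 < f u)
  (F_gt : forall u, l < u < r -> x0 < F u)
  (F_surj : forall x, x0 < x -> exists2 u, l < u < r & F u = x).

(** The default 0 is returned only when x is not a value of [F] on ]l, r[, which does not happen
    above x0. *)
Definition inv_itv (x : R) : R := xget 0 [set u | l < u < r /\ F u = x].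

Let G := inv_itv.

Lemma inv_itvP x : x0 < x -> l < G x < r /\ F (G x) = x.
Proof.
move=> /F_surj[u u_itv Fu].
by rewrite /G /inv_itv; case: xgetP => [_ -> //|/(_ u)[]].
Qed.

Lemma incr_itv u v : l < u -> u < v -> v < r -> F u < F v.
Proof.
move=> lu uv vr.
have [c /andP[uc cv] FE] := MVT_itvoo _ _ _ _ _ _ FdF lu uv vr.
rewrite -subr_gt0 FE mulr_gt0 ?subr_gt0// f_gt0//.
by rewrite (lt_trans lu uc) (lt_trans cv vr).
Qed.

Lemma inv_itvK u : l < u < r -> G (F u) = u.
Proof.
move=> /[dup] u_itv /andP[lu ur].
have [/andP[lG Gr] FG] := inv_itvP _ (F_gt _ u_itv).
have [Gu|uG|//] := ltgtP (G (F u)) u.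
- by have := incr_itv _ _ lG Gu ur; rewrite FG ltxx.
- by have := incr_itv _ _ lu uG Gr; rewrite FG ltxx.
Qed.

Lemma inv_itv_lt x u : x0 < x -> l < u < r -> (G x < u) = (x < F u).
Proof.
move=> xx0 u_itv; have [/andP[lG Gr] FG] := inv_itvP _ xx0.
have /andP[lu ur] := u_itv.
apply/idP/idP => [Gu|]; first by rewrite -[X in X < _]FG incr_itv.
rewrite -[X in X < _ -> _]FG; apply: contraTT; rewrite -!leNgt le_eqVlt.
by move=> /predU1P[->//|uG]; rewrite ltW// incr_itv.
Qed.

Lemma inv_itv_incr x y : x0 < x -> x < y -> G x < G y.
Proof.
move=> xx0 xy; have yx0 := lt_trans xx0 xy.
by have [Gy FG] := inv_itvP _ yx0; rewrite inv_itv_lt// FG.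
Qed.

Lemma is_derive_inv_itv x : x0 < x -> is_derive x 1 G (f (G x))^-1.
Proof.
move=> xx0; have [Gx FG] := inv_itvP _ xx0.
have nG : \forall u \near G x, l < u < r.
  have Gin : G x \in `]l, r[ by rewrite in_itv.
  by apply: filterS (near_in_itvoo Gin) => u; rewrite in_itv.
rewrite -[X in is_derive X]FG; apply: (@is_derive_inverse _ F).
- near=> u; apply: inv_itvK.
  by near: u.
- near=> u; apply: (is_derive_continuous _ _ _ (FdF _ _)).
  by near: u.
- exact: FdF.
- by rewrite gt_eqF// f_gt0.
Unshelve. all: by end_near. Qed.

Lemma cvgy_inv_itv : G x @[x --> +oo] --> r.
Proof.
apply/cvgrPdist_lt => e e0.
(* The midpoint keeps [u] inside ]l, r[ when r - e is not above l. *)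
pose u := Num.max (r - e) ((l + r) / 2).
have u_itv : l < u < r.
  have [lm mr] := midf_lt lr.
  by rewrite lt_max gt_max lm mr gtrBl e0 orbT.
near=> x.
have xF : F u < x by near: x; apply: nbhs_pinfty_gt; rewrite num_real.
have xx0 : x0 < x := lt_trans (F_gt _ u_itv) xF.
have [/andP[lG Gr] FG] := inv_itvP _ xx0.
rewrite ger0_norm ?subr_ge0 ?(ltW Gr)// ltrBlDr -ltrBlDl.
apply: (@le_lt_trans _ _ u); first by rewrite le_max lexx.
by rewrite -(inv_itvK _ u_itv); apply: inv_itv_incr => //; exact: F_gt.
Unshelve. all: by end_near. Qed.

(** The density of F(U) for U uniform on ]l, r[. The value at the single point x0 does not affect
    integrals; +oo is the limit from the right in the application to V^s, as psi blows up at 0, and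
    keeps the density decreasing on the closed half-line. *)
Definition inv_density (x : R) : \bar R :=
  if x0 < x then ((r - l)^-1 / f (G x))%:E else if x < x0 then 0%E else +oo%E.

Hypothesis f_cont : forall u, l < u < r -> {for u, continuous f}.

Let rl_gt0 : 0 < (r - l)^-1. Proof. by rewrite invr_gt0 subr_gt0. Qed.

Lemma inv_density_cont x : x0 < x ->
  {for x, continuous (fun y => (r - l)^-1 / f (G y))}.
Proof.
move=> xx0; have [Gx FG] := inv_itvP _ xx0.
apply: cvgM; first exact: cvg_cst.
apply: cvgV; first by rewrite gt_eqF// f_gt0.
apply: (@continuous_comp _ _ _ G f); last exact: f_cont.
exact: is_derive_continuous (is_derive_inv_itv _ xx0).
Qed.

Lemma inv_density_ge0 x : (0 <= inv_density x)%E.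
Proof.
rewrite /inv_density; case: ifPn => [xx0|_]; last by case: ifPn.
have [Gx FG] := inv_itvP _ xx0.
by rewrite lee_fin divr_ge0 ?(ltW rl_gt0)// ltW// f_gt0.
Qed.

Lemma measurable_inv_density : measurable_fun [set: R] inv_density.
Proof.
rewrite /inv_density; apply: measurable_fun_if => //=.
- exact: measurable_fun_ltr.
- rewrite setTI; apply/measurable_EFinP.
  rewrite (_ : _ @^-1` _ = `]x0, +oo[%classic); last first.
    by apply/seteqP; split => z /=; rewrite in_itv/= andbT.
  apply: open_continuous_measurable_fun; first exact: interval_open.
  by move=> x; rewrite inE/= in_itv/= andbT; exact: inv_density_cont.
- apply: measurable_funTS; apply: measurable_fun_if => //=.
  exact: measurable_fun_ltr.
Qed.

(** The function (r - l)^-1 G is a primitive of the density and tends to (r - l)^-1 r at +oo. *)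
Lemma integral_inv_density c : x0 < c ->
  (\int[lebesgue_measure]_(x in `]c, +oo[) inv_density x =
   ((r - l)^-1 * (r - G c))%:E)%E.
Proof.
move=> cx0.
rewrite integral_itv_obnd_cbnd//; last first.
  by apply: measurable_funTS; exact: measurable_inv_density.
under eq_integral.
  move=> x; rewrite inE/= in_itv/= andbT => cx.
  rewrite /inv_density (lt_le_trans cx0 cx); over.
have dG x : c <= x -> is_derive x 1 (fun y => (r - l)^-1 * G y)
    ((r - l)^-1 / f (G x)).
  move=> cx; have dG := is_derive_inv_itv _ (lt_le_trans cx0 cx).
  by derive_tac; ring.
rewrite (@ge0_continuous_FTC2y R _ (fun x => (r - l)^-1 * G x) c
  ((r - l)^-1 * r)).
- by rewrite -EFinB mulrBr.
- move=> x cx; have [Gx FG] := inv_itvP _ (lt_le_trans cx0 cx).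
  by rewrite divr_ge0 ?(ltW rl_gt0)// ltW// f_gt0.
- apply: continuous_in_subspaceT => x; rewrite inE/= in_itv/= andbT => cx.
  exact: inv_density_cont (lt_le_trans cx0 cx).
- by apply: cvgM; [exact: cvg_cst|exact: cvgy_inv_itv].
- by move=> x /ltW/dG[].
- by apply: cvg_at_right_filter; apply: (is_derive_continuous _ _ _ (dG _ _)).
- move=> x; rewrite in_itv/= andbT => /ltW/dG[_ <-].
  by rewrite derive1E.
Qed.

Lemma inv_density_is_density (m : {measure set R -> \bar R}) :
  (forall c, x0 < c -> m `]c, +oo[%classic = ((r - l)^-1 * (r - G c))%:E) ->
  m `]-oo, x0]%classic = 0%E -> (m [set: R] < +oo)%E ->
  is_density m inv_density.
Proof.
move=> mray m0 moo; split; [exact: measurable_inv_density|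
  exact: inv_density_ge0|].
apply: (measure_unique_ray_above m
  (measure_of_density _ measurable_inv_density inv_density_ge0) x0) => //.
- by move=> c cx0; rewrite mray// -integral_inv_density.
(* The endpoint x0, where the density is +oo, is first removed as a null set. *)
- rewrite /measure_of_density/= /density_measure -integral_itv_bndo_bndc.
    rewrite (eq_integral (cst 0%E)) ?integral0// => x.
    by rewrite inE/= in_itv/= => xx0; rewrite /inv_density ltNge (ltW xx0) xx0.
  by apply: measurable_funTS; exact: measurable_inv_density.
Qed.

End inverse.

(** * The law of V^s *)

Section power_of_V.
Context {R : realType}.
Variables a b c : R.
Hypotheses (a_gt0 : 0 < a) (b_gt0 : 0 < b) (ab1 : a + b = 1) (c_gt0 : 0 < c).

Definition Vpow u := expR (c * Nlnb a b u).

Definition dVpow u := c * Vpow u / psi a b u.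

Definition Vpow_inf := expR (c * (a * ln a + b * ln b)).

Lemma is_derive_Vpow u : 0 < u < pi -> is_derive u 1 Vpow (dVpow u).
Proof.
move=> u0; have dN := is_derive_Nlnb _ _ a_gt0 b_gt0 ab1 _ u0.
have dcN : is_derive u 1 (fun v => c * Nlnb a b v) (c / psi a b u).
  by derive_tac; ring.
have dE := is_derive_compf expR _ u _ _ (is_derive_expR _) dcN.
by apply: (is_derive_eq dE); rewrite /dVpow /Vpow; ring.
Qed.

Lemma dVpow_gt0 u : 0 < u < pi -> 0 < dVpow u.
Proof. by move=> u0; rewrite !mulr_gt0 ?expR_gt0 ?invr_gt0 ?psi_gt0. Qed.

Lemma Vpow_gt_inf u : 0 < u < pi -> Vpow_inf < Vpow u.
Proof. by move=> u0; rewrite ltr_expR ltr_pM2l// Nlnb_gt_lim0. Qed.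

Lemma Vpow_surj x : Vpow_inf < x -> exists2 u, 0 < u < pi & Vpow u = x.
Proof.
move=> xx0; have x0 : 0 < x by apply: lt_trans xx0; exact: expR_gt0.
have [|u u0 NE] := Nlnb_surj _ _ a_gt0 b_gt0 ab1 (ln x / c).
  by rewrite ltr_pdivlMr// mulrC -ltr_expR lnK.
by exists u => //; rewrite /Vpow NE mulrC divfK ?gt_eqF// lnK.
Qed.

Lemma continuous_dVpow u : 0 < u < pi -> {for u, continuous dVpow}.
Proof.
move=> u0; have dV := is_derive_Vpow _ u0.
have dp := is_derive_psi _ _ a_gt0 b_gt0 ab1 _ u0.
have dpV := is_deriveVf _ _ _ (lt0r_neq0 (psi_gt0 _ _ a_gt0 b_gt0 ab1 _ u0)) dp.
rewrite (_ : dVpow = fun u => c * Vpow u * (psi a b u)^-1)//.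
exact: (@is_derive_continuous R (fun u => c * Vpow u * (psi a b u)^-1) u).
Qed.

Let G := inv_itv 0 pi Vpow.

Let GP x : Vpow_inf < x -> 0 < G x < pi /\ Vpow (G x) = x.
Proof. exact: inv_itvP Vpow_surj x. Qed.

Let dG x : Vpow_inf < x -> is_derive x 1 G (dVpow (G x))^-1.
Proof.
exact: is_derive_inv_itv is_derive_Vpow dVpow_gt0 Vpow_gt_inf Vpow_surj x.
Qed.

Let G_ndecr x y : Vpow_inf < x -> x <= y -> G x <= G y.
Proof.
move=> xx0; rewrite le_eqVlt => /predU1P[->//|xy]; apply: ltW.
exact: inv_itv_incr is_derive_Vpow dVpow_gt0 Vpow_surj x y xx0 xy.
Qed.

Definition Vpow_density := inv_density 0 pi Vpow_inf Vpow dVpow.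

Let x_gt0 x : Vpow_inf < x -> 0 < x.
Proof. exact/lt_trans/expR_gt0. Qed.

Let pc0 : 0 < pi * c. Proof. by rewrite mulr_gt0// pi_gt0. Qed.

Lemma Vpow_densityE x : Vpow_inf < x ->
  Vpow_density x = (psi a b (G x) / (pi * c * x))%:E.
Proof.
move=> xx0; rewrite /Vpow_density /inv_density xx0 subr0.
have [Gx VG] := GP _ xx0.
by rewrite -/G /dVpow VG invf_div mulrCA -invfM mulrA.
Qed.

Lemma Vpow_density_inf : Vpow_density Vpow_inf = +oo%E.
Proof. by rewrite /Vpow_density /inv_density ltxx. Qed.

Lemma psi_nincr u v : 0 < u -> u <= v -> v < pi -> psi a b v <= psi a b u.
Proof.
move=> u0 uv vpi; rewrite -lerN2.
apply: (nondecreasing_itvoo (fun u => - psi a b u) (fun u => - dpsi a b u)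
  0 pi) => // z z0.
  by have dp := is_derive_psi _ _ a_gt0 b_gt0 ab1 _ z0; derive_tac.
by rewrite oppr_ge0 dpsi_le0_sym.
Qed.

(** Strictness comes from the factor 1 / x, psi being nonincreasing along the nondecreasing inverse,
    and at the left endpoint from the value +oo. *)
Lemma Vpow_density_decr x y : Vpow_inf <= x -> x < y ->
  (Vpow_density y < Vpow_density x)%E.
Proof.
rewrite le_eqVlt => /predU1P[<-|xx0] xy.
  by rewrite Vpow_density_inf Vpow_densityE// ltry.
have yx0 := lt_trans xx0 xy; rewrite !Vpow_densityE// lte_fin.
have [Gx _] := GP _ xx0; have [Gy _] := GP _ yx0.
have pcx := mulr_gt0 pc0 (x_gt0 _ xx0); have pcy := mulr_gt0 pc0 (x_gt0 _ yx0).
apply: (@lt_le_trans _ _ (psi a b (G y) / (pi * c * x))).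
  by rewrite ltr_pM2l ?psi_gt0// ltf_pV2 ?posrE// ltr_pM2l.
rewrite ler_pM2r ?invr_gt0//.
case/andP: Gx => Gx0 Gxpi; case/andP: Gy => Gy0 Gypi.
by apply: psi_nincr => //; apply: G_ndecr => //; exact: ltW.
Qed.

Let L x := ln (psi a b (G x) / (pi * c * x)).

Let dL x := (dpsi a b (G x) / c - 1) / x.

(** As G' = psi(G x) / (c x), the factor psi cancels in the derivative of ln (psi(G x)), leaving
    psi'(G x) / (c x). *)
Let is_derive_L x : Vpow_inf < x -> is_derive x 1 L (dL x).
Proof.
move=> xx0; have [Gx VG] := GP _ xx0.
have p0 := psi_gt0 _ _ a_gt0 b_gt0 ab1 _ Gx; have x0 := x_gt0 _ xx0.
have q0 : 0 < psi a b (G x) / (pi * c * x) by rewrite divr_gt0// mulr_gt0.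
have dpG := is_derive_compf _ _ _ _ _
  (is_derive_psi _ _ a_gt0 b_gt0 ab1 _ Gx) (dG _ xx0).
have dM : is_derive x 1 (fun y => pi * c * y) (pi * c) by derive_tac; ring.
have dV := is_deriveVf _ _ _ (lt0r_neq0 (mulr_gt0 pc0 x0)) dM.
have dq := is_deriveMf _ _ _ _ _ dpG dV.
have dl := is_derive_compf (@ln R) (fun x => psi a b (G x) / (pi * c * x)) x
  _ _ (is_derive1_ln q0) dq.
apply: (is_derive_eq dl); rewrite /dL /dVpow VG.
move: (lt0r_neq0 (pi_gt0 R)) (lt0r_neq0 p0) (lt0r_neq0 x0) (lt0r_neq0 c_gt0).
move: (@pi R) (psi a b (G x)) => q p q_neq0 p_neq0 x_neq0 c_neq0.
by field; rewrite x_neq0 c_neq0 q_neq0 p_neq0.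
Qed.

Let dL_ndecr x y : Vpow_inf < x -> x <= y -> dL x <= dL y.
Proof.
move=> xx0 xy; have yx0 := lt_le_trans xx0 xy.
have [/andP[Gx0 Gxpi] _] := GP _ xx0; have [/andP[Gy0 Gypi] _] := GP _ yx0.
have x0 := x_gt0 _ xx0; have y0 := x_gt0 _ yx0.
(* The numerator is negative because psi' <= 0, so enlarging the denominator increases the quotient;
   the numerator is increased afterwards. *)
rewrite /dL; apply: (@le_trans _ _ ((dpsi a b (G x) / c - 1) / y)).
  rewrite ler_wnM2l ?lef_pV2 ?posrE// subr_le0.
  apply: (@le_trans _ _ 0) => //; rewrite mulr_le0_ge0 ?invr_ge0 ?(ltW c_gt0)//.
  by rewrite dpsi_le0_sym// Gx0.
rewrite ler_pM2r ?invr_gt0// lerD2r ler_pM2r ?invr_gt0//.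
by apply: dpsi_ndecr_sym => //; exact: G_ndecr.
Qed.

Lemma Vpow_density_log_convex :
  log_convex_on `[Vpow_inf, +oo[%classic Vpow_density.
Proof.
have lneE x : Vpow_inf < x -> lne (Vpow_density x) = (L x)%:E.
  move=> xx0; have [Gx _] := GP _ xx0; rewrite Vpow_densityE// lne_EFin//.
  by rewrite divr_gt0 ?psi_gt0// (mulr_gt0 pc0 (x_gt0 _ xx0)).
split=> [x|x y t]; rewrite /= !in_itv/= !andbT.
  rewrite le_eqVlt => /predU1P[<-|xx0]; first by rewrite Vpow_density_inf.
  rewrite Vpow_densityE// lte_fin.
  have [Gx _] := GP _ xx0.
  by rewrite divr_gt0 ?psi_gt0// (mulr_gt0 pc0 (x_gt0 _ xx0)).
move=> xx0 yx0 /andP[]; rewrite le_eqVlt => /predU1P[<- _|t0].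
  by rewrite mul0r add0r subr0 mul1r mul0e add0e mul1e.
rewrite le_eqVlt => /predU1P[->|t1].
  by rewrite subrr mul0r addr0 mul1r mul0e adde0 mul1e.
have t1' : 0 < 1 - t by rewrite subr_gt0.
(* If x or y is the left endpoint, its term is +oo since both weights are now positive; the sum is
   +oo because the other term is not -oo. *)
have mulNy k z : 0 < k -> Vpow_inf <= z ->
    (k%:E * lne (Vpow_density z) != -oo)%E.
  move=> k0; rewrite le_eqVlt => /predU1P[<-|zx0].
    by rewrite Vpow_density_inf/= gt0_muley ?lte_fin.
  by rewrite lneE.
move: (xx0); rewrite le_eqVlt => /predU1P[<-|xx1].
  rewrite [in leRHS]Vpow_density_inf/= gt0_muley ?lte_fin//.
  by rewrite addye ?mulNy// leey.
move: (yx0); rewrite le_eqVlt => /predU1P[<-|yx1].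
  rewrite [in leRHS]Vpow_density_inf/= gt0_muley ?lte_fin//.
  by rewrite addey ?mulNy// leey.
have mx0 : Vpow_inf < t * x + (1 - t) * y.
  have : t * Vpow_inf < t * x by rewrite ltr_pM2l.
  have : (1 - t) * Vpow_inf < (1 - t) * y by rewrite ltr_pM2l.
  by rewrite -[X in _ -> _ -> X < _](subrK (t * Vpow_inf)); lra.
rewrite !lneE// -!EFinM -EFinD lee_fin.
by apply: (convex_ndecr_derive _ _ _ is_derive_L dL_ndecr);
  rewrite ?(ltW t0)// ltW.
Qed.

End power_of_V.

(** * From the uniform law to the law of V^s *)

Section law_of_V.
Context {R : realType}.

Lemma powR_expR (x p : R) : 0 < x -> x `^ p = expR (p * ln x).
Proof. by move=> x0; rewrite /powR gt_eqF. Qed.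

Lemma uniform_probE (p q : R) (pq : p < q) (A : set R) : measurable A ->
  uniform_prob pq A = ((q - p)^-1%:E * lebesgue_measure (A `&` `[p, q]))%E.
Proof.
move=> mA; rewrite /uniform_prob integral_uniform_pdf.
rewrite (eq_integral (cst (q - p)^-1%:E)).
  by rewrite integral_cst//; exact: measurableI.
move=> x; rewrite inE/= => -[_]; rewrite /= in_itv/= /uniform_pdf => ->//.
Qed.

Variables alpha s : R.
Hypotheses (alpha_gt0 : 0 < alpha) (alpha_lt1 : alpha < 1) (s_gt0 : 0 < s).

Let beta := 1 - alpha.
Let beta_gt0 : 0 < beta. Proof. by rewrite subr_gt0. Qed.
Let ab1 : alpha + beta = 1. Proof. by rewrite addrC subrK. Qed.
Let c := s / beta.
Let c_gt0 : 0 < c. Proof. exact: divr_gt0. Qed.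

Definition Vs (u : R) := (b_ alpha u `^ (- beta^-1)) `^ s.

Lemma measurable_Vs : measurable_fun [set: R] Vs.
Proof.
apply: (@measurableT_comp _ _ _ _ _ _ (@powR R ^~ _)) => //.
apply: (@measurableT_comp _ _ _ _ _ _ (@powR R ^~ _)) => //.
exact: measurable_b_.
Qed.

Lemma VsE u : 0 < u < pi -> Vs u = Vpow alpha beta c u.
Proof.
move=> u0; have su := sin_gt0_pi u0.
have sa := sin_gt0_pi (mulr_itv0pi _ _ alpha_gt0 (ltW alpha_lt1) u0).
have beta_le1 : beta <= 1 by rewrite -ab1 lerDr ltW.
have sb := sin_gt0_pi (mulr_itv0pi _ _ beta_gt0 beta_le1 u0).
have b0 : 0 < b_ alpha u by rewrite /b_ mulr_gt0// powR_gt0// divr_gt0.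
rewrite /Vs powR_expR ?powR_gt0// ln_powR /Vpow /Nlnb; congr expR.
rewrite /b_ -/beta lnM ?posrE ?powR_gt0 ?divr_gt0// !ln_powR.
rewrite !ln_div ?posrE// /c.
have bE : alpha = 1 - beta by rewrite -ab1 addrK.
have := lt0r_neq0 beta_gt0.
move: (ln _) (ln _) (ln _) => x y z; rewrite bE; move: beta => b b_neq0.
by field.
Qed.

(** This handles the endpoints 0 and pi. There b_alpha is 0, and [powR] sends 0 to 0 for every
    nonzero exponent, negative ones included, so V^s takes a value below its support on this null
    set. *)
Lemma Vs_sin0 u : sin u = 0 -> Vs u = 0.
Proof.
move=> su; rewrite /Vs /b_ su !mul0r powR0 ?gt_eqF// mul0r.
have bN0 : - beta^-1 != 0 by rewrite oppr_eq0 invr_eq0 gt_eqF.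
by rewrite (powR0 bN0) powR0// gt_eqF.
Qed.

Lemma Vpow_infE : Vpow_inf alpha beta c = (beta * alpha `^ (alpha / beta)) `^ s.
Proof.
rewrite powR_expR ?mulr_gt0 ?powR_gt0// lnM ?posrE ?powR_gt0// ln_powR.
congr expR; rewrite /c; have := lt0r_neq0 beta_gt0.
by move: (ln _) (ln _) => x y; move: beta => b b_neq0; field.
Qed.

End law_of_V.

Theorem corollary3p1 (R : realType) (d : measure_display)
    (T : measurableType d) (P : probability T R) (U : {RV P >-> R})
    (unifU : forall A : set R, measurable A ->
      distribution P U A = uniform_prob (pi_gt0 R) A)
    (alpha : R) (alpha_gt0 : 0 < alpha) (alpha_lt1 : alpha < 1)
    (s : R) (s_gt0 : 0 < s) :
  let beta := 1 - alpha in
  let supp := `[(beta * alpha `^ (alpha / beta)) `^ s, +oo[%classic in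
  exists f : R -> \bar R,
    [/\ is_density (distribution P (powRV (V_ alpha U) s)) f,
        {in supp &, forall x y, x < y -> (f y < f x)%E} &
        log_convex_on supp f].
Proof.
move=> beta supp; pose c := s / beta.
have beta_gt0 : 0 < beta by rewrite subr_gt0.
have ab1 : alpha + beta = 1 by rewrite addrC subrK.
have c_gt0 : 0 < c by exact: divr_gt0.
pose x0 := Vpow_inf alpha beta c.
have suppE : supp = `[x0, +oo[%classic by rewrite /supp -Vpow_infE.
exists (Vpow_density alpha beta c); rewrite suppE; split; last 2 first.
- move=> x y; rewrite !inE/= !in_itv/= !andbT => xx0 _.
  exact: Vpow_density_decr.
- exact: Vpow_density_log_convex.
have lawE (A : set R) : measurable A ->
    distribution P (powRV (V_ alpha U) s) A =
    (pi^-1%:E * lebesgue_measure ((Vs alpha s @^-1` A) `&` `[0%R, pi]))%E.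
  move=> mA; have mVA : measurable (Vs alpha s @^-1` A).
    by rewrite -[X in measurable X]setTI; exact: measurable_Vs.
  transitivity (uniform_prob (pi_gt0 R) (Vs alpha s @^-1` A)).
    by rewrite -unifU.
  by rewrite uniform_probE// subr0.
have Vs0 : Vs alpha s 0 = 0 by apply: Vs_sin0 => //; exact: sin0.
have Vspi : Vs alpha s pi = 0 by apply: Vs_sin0 => //; exact: sinpi.
have x0_gt0 : 0 < x0 by exact: expR_gt0.
have itvE u : 0 <= u <= pi -> [\/ u = 0, u = pi | 0 < u < pi].
  move=> /andP[]; rewrite le_eqVlt => /predU1P[<-|u0]; first by constructor 1.
  rewrite le_eqVlt => /predU1P[->|upi]; first by constructor 2.
  by constructor 3; rewrite u0.
apply: inv_density_is_density.
- exact: pi_gt0.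
- exact: is_derive_Vpow.
- exact: dVpow_gt0.
- exact: Vpow_gt_inf.
- exact: Vpow_surj.
- exact: continuous_dVpow.
- move=> y yx0; apply: (eq_trans (lawE _ (measurable_itv _))); rewrite subr0.
  have [Gy VG] := inv_itvP 0 pi x0 _
    (Vpow_surj _ _ _ alpha_gt0 beta_gt0 ab1 c_gt0) _ yx0.
  have GltE u : 0 < u < pi ->
      (inv_itv 0 pi (Vpow alpha beta c) y < u) = (y < Vpow alpha beta c u).
    move=> u0; apply: (inv_itv_lt 0 pi x0 _ (dVpow alpha beta c)) => //.
    - exact: is_derive_Vpow.
    - exact: dVpow_gt0.
    - exact: Vpow_surj.
  (* The event V^s > y is U > G(y): the endpoints drop out since V^s is 0 there, and the remaining
     interval has length pi - G(y). *)
  rewrite (_ : _ `&` _ = `]inv_itv 0 pi (Vpow alpha beta c) y, pi[%classic).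
    rewrite lebesgue_measure_itv/= lte_fin; case/andP: Gy => _ ->.
    by rewrite -EFinB -EFinM.
  apply/seteqP; split => u /=; rewrite !in_itv/=.
    move=> [yu /itvE[u0|u0|u0]].
    - by move: yu; rewrite u0 Vs0 ltNge (ltW (lt_trans x0_gt0 yx0)).
    - by move: yu; rewrite u0 Vspi ltNge (ltW (lt_trans x0_gt0 yx0)).
    - by move: yu; rewrite andbT VsE// -GltE// => ->; case/andP: u0.
  move=> /andP[Gu upi].
  have u0 : 0 < u by case/andP: Gy => Gy0 _; exact: lt_trans Gu.
  have u0pi : 0 < u < pi by rewrite u0.
  by rewrite VsE// -GltE// Gu (ltW u0) (ltW upi).
(* Inside ]0, pi[ the variable exceeds x0, so only the two endpoints, a null set, are mapped to
   ]-oo, x0]. *)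
- apply: (eq_trans (lawE _ (measurable_itv _)));
  rewrite (_ : _ `&` _ = [set 0; pi]); last first.
    apply/seteqP; split => u /=; rewrite !in_itv/=.
      move=> [ux0 /itvE[u0|u0|u0]]; [by left|by right|].
      by move: ux0; rewrite VsE// leNgt Vpow_gt_inf.
    by case=> ->; rewrite ?Vs0 ?Vspi (ltW x0_gt0) lexx pi_ge0.
  rewrite countable_lebesgue_measure0 ?mule0//.
  exact/finite_set_countable.
- apply: le_lt_trans (ltry 1).
  exact: (probability_le1 (distribution P (powRV (V_ alpha U) s)) measurableT).
Qed.
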